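(* Let $\mathfrak{g}$ be a split real form with root system $\Pi$, simple system $\Sigma$ and Weyl group $\mathcal{W}$. Let $w,w'\in\mathcal{W}$ be such that $w$ covers $w'$, let $w=s_1\cdots s_\ell$ be a reduced decomposition, where $s_k$ is the reflection in the simple root $\delta_k\in\Sigma$ (repetitions allowed), and let $I\in\{1,\dots,\ell\}$ be such that $w'=s_1\cdots\widehat{s_I}\cdots s_\ell$ (this being a reduced decomposition of $w'$). Put $u=s_{I+1}\cdots s_\ell$ and let $\gamma=u^{-1}(\delta_I)$, which is the root for which $w=w'\cdot s_\gamma$. Then $$\kappa(w,w')=\mathrm{ht}(\gamma^\vee),$$ where $\mathrm{ht}(\gamma^\vee)$ is the height of the coroot $\gamma^\vee$ in the dual root system $\Pi^*$.
   Context: $\mathfrak{g}$ is a real noncompact semisimple Lie algebra with Cartan decomposition $\mathfrak{g}=\mathfrak{k}\oplus\mathfrak{s}$ and $\mathfrak{a}\subset\mathfrak{s}$ maximal abelian; $\mathfrak{g}$ is a split real form if $\mathfrak{a}$ is a Cartan subalgebra of $\mathfrak{g}$ (so the root system is reduced and all root spaces have dimension 1). $\Pi$ is the set of roots of $(\mathfrak{g},\mathfrak{a})$, $\mathfrak{g}_\alpha$ is the root space of $\alpha\in\Pi$, $\Sigma\subset\Pi$ is a simple system, $\Pi^{+},\Pi^{-}$ are the positive and negative roots, and $\mathcal{W}$ is the Weyl group, with length function $\ell$ and Bruhat order $\le$ with respect to $\Sigma$. $w$ covers $w'$ means $w'\le w$ and $\ell(w)=\ell(w')+1$. The hat denotes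 an omitted factor. With a $\mathcal{W}$-invariant inner product $\langle\cdot,\cdot\rangle$, the coroot of $\alpha$ is $\alpha^\vee=2\alpha/\langle\alpha,\alpha\rangle$ and $s_\alpha(\beta)=\beta-\langle\alpha^\vee,\beta\rangle\alpha$. The dual root system is $\Pi^*=\{\alpha^\vee:\alpha\in\Pi\}$, with simple system $\Sigma^*=\{\delta^\vee:\delta\in\Sigma\}$. The height of a root is the sum of its coefficients when expressed in the simple roots; so if $\gamma^\vee=\sum_{\delta\in\Sigma}d^*_\delta\,\delta^\vee$ then $\mathrm{ht}(\gamma^\vee)=\sum_\delta d^*_\delta$. For $w\in\mathcal{W}$ let $\Pi_w=\Pi^+\cap w\Pi^-$ and $\phi(w)=\sum_{\delta\in\Pi_w}\dim\mathfrak{g}_\delta\cdot\delta$. If $w$ covers $w'$, let $\beta=s_1\cdots s_{I-1}(\delta_I)$, which is the unique positive root with $w=s_\beta w'$; the integer $\kappa(w,w')$ is defined by $\phi(w)-\phi(w')=\kappa(w,w')\cdot\beta$. *)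

(* Defs.v *)
From HB Require Import structures.
From mathcomp Require Import all_boot all_order all_algebra.
From mathcomp Require Import all_classical reals.

Set Implicit Arguments.
Unset Strict Implicit.
Unset Printing Implicit Defensive.

Import Order.TTheory GRing.Theory Num.Theory.
Local Open Scope ring_scope.
Local Open Scope classical_set_scope.

HB.mixin Record Vector_isLie (F : fieldType) L of Vector F L := {
  lie : L -> L -> L;
  lie_linear_l : forall y, linear (fun x => lie x y);
  lie_linear_r : forall x, linear (lie x);
  lie_alternating : forall x, lie x x = 0;
  lie_jacobi : forall x y z,
    lie x (lie y z) + lie y (lie z x) + lie z (lie x y) = 0
}.

#[short(type="lieVectType")]
HB.structure Definition LieVect (F : fieldType) :=
  { L of Vector F L & Vector_isLie F L }.

Section LieAlgebra.
Variables (F : fieldType) (g : lieVectType F).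
Implicit Types (U V I h : {vspace g}) (x y : g).

HB.instance Definition _ x :=
  GRing.isLinear.Build F g g _ (lie x) (lie_linear_r x).

Definition ad x : 'End(g) := linfun (lie x).

Definition lfun_trace (V : vectType F) (f : 'End(V)) : F :=
  \tr (passmx.mxof (vbasis fullv) (vbasis fullv) f).

Definition killing x y : F := lfun_trace (ad x \o ad y)%VF.

Definition lie_prod U V : {vspace g} :=
  <<[seq lie x y | x <- vbasis U, y <- vbasis V]>>%VS.

Definition is_lie_ideal I := forall x y, y \in I -> lie x y \in I.

Definition is_lie_subalgebra h :=
  forall x y, x \in h -> y \in h -> lie x y \in h.

Definition is_abelian h := forall x y, x \in h -> y \in h -> lie x y = 0.

Definition is_solvable I :=
  exists n, iter n (fun U => lie_prod U U) I = 0%VS.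

Definition is_nilpotent h := exists n, iter n (lie_prod h) h = 0%VS.

Definition is_semisimple :=
  forall I, is_lie_ideal I -> is_solvable I -> I = 0%VS.

Definition is_cartan_subalgebra h :=
  [/\ is_lie_subalgebra h, is_nilpotent h &
      forall x, (forall y, y \in h -> lie x y \in h) -> x \in h].

End LieAlgebra.

Arguments is_semisimple {F} g.

Section RealForm.
Variables (R : realType) (g : lieVectType R).
Implicit Types (k s a : {vspace g}).

(* For a semisimple real Lie algebra, compactness is negative definiteness of
   the Killing form. *)
Definition is_noncompact :=
  ~ (forall x : g, x != 0 -> killing x x < 0).

(* The map equal to 1 on k and to -1 on s is an automorphism by the bracket
   relations, and it is a Cartan involution by the sign conditions. *)
Definition is_cartan_decomposition k s :=
  [/\ (k + s)%VS = fullv /\ (k :&: s)%VS = 0%VS,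
      forall x y, x \in k -> y \in k -> lie x y \in k,
      forall x y, x \in k -> y \in s -> lie x y \in s,
      forall x y, x \in s -> y \in s -> lie x y \in k &
      (forall x, x \in k -> x != 0 -> killing x x < 0) /\
      (forall x, x \in s -> x != 0 -> 0 < killing x x)].

Definition is_maximal_abelian_in s a :=
  [/\ (a <= s)%VS, is_abelian a &
      forall b : {vspace g}, (a <= b)%VS -> (b <= s)%VS -> is_abelian b ->
        b = a].

Record is_split_real_form k s a : Prop := {
  split_semisimple : is_semisimple g;
  split_noncompact : is_noncompact;
  split_cartan_decomposition : is_cartan_decomposition k s;
  split_maximal_abelian : is_maximal_abelian_in s a;
  split_cartan_subalgebra : is_cartan_subalgebra a
}.

End RealForm.

Notation dual_space R a := 'Hom(subvs_of a, R^o).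

Section Roots.
Variables (R : realType) (g : lieVectType R) (a : {vspace g}).
Local Notation E := (dual_space R a).
Implicit Types (alpha beta : E) (ip : E -> E -> R).

Definition root_space alpha : {vspace g} :=
  (\bigcap_(h <- vbasis {: subvs_of a})
     lker (ad (vsval h) - (alpha h : R) *: \1%VF))%VS.

Lemma mem_root_space alpha (x : g) :
  x \in root_space alpha <->
  forall h : subvs_of a, lie (vsval h) x = (alpha h : R) *: x.
Proof.
pose f h : g := ad (vsval h) x - (alpha h : R) *: x.
have flin : linear f.
  move=> c h1 h2; rewrite /f /ad !lfunE /= !linearP /= lie_linear_l.
  by rewrite scalerDl opprD scalerBr -!scalerA addrACA.
pose fL : {linear subvs_of a -> g} :=
  HB.pack f (GRing.isLinear.Build R _ _ _ f flin).
have eqf h : (lie (vsval h) x = (alpha h : R) *: x) <-> fL h = 0.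
  rewrite /fL /= /f /ad lfunE /=.
  by split=> [->|/eqP]; rewrite ?subrr // subr_eq0 => /eqP.
have memf h :
    (x \in lker (ad (vsval h) - (alpha h : R) *: \1%VF)%R) = (fL h == 0).
  by rewrite memv_ker add_lfunE opp_lfunE scale_lfunE id_lfunE.
have -> : (x \in root_space alpha) =
    all (fun h => fL h == 0) (vbasis {: subvs_of a}).
  rewrite /root_space; elim: (tval _) => [|h s IHs] /=.
    by rewrite big_nil memvf.
  by rewrite big_cons memv_cap IHs memf.
split=> [/allP f0 h|f0]; last first.
  by apply/allP => h _; apply/eqP/eqf.
apply/eqf; rewrite (coord_vbasis (memvf h)) linear_sum big1 // => i _.
by rewrite linearZ_LR (eqP (f0 _ _)) ?scaler0 ?mem_nth ?size_tuple.
Qed.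

Definition root_set : set E :=
  [set alpha | alpha != 0 /\ root_space alpha != 0%VS].

Definition coroot ip alpha : E := (2 / ip alpha alpha) *: alpha.

Definition reflection ip alpha : 'End(E) :=
  linfun (fun beta : E => beta - ip (coroot ip alpha) beta *: alpha).

(* The vector of a representing the linear form alpha for the restriction to a
   of the Killing form, which is positive definite when a is contained in the
   space s of a Cartan decomposition. *)
Definition killing_vec alpha : subvs_of a :=
  xget 0 [set t : subvs_of a |
           forall h : subvs_of a, killing (vsval t) (vsval h) = alpha h].

Definition killing_dual alpha beta : R := beta (killing_vec alpha).

Definition refl_prod ip (d : seq E) : 'End(E) :=
  foldr (fun alpha w => (reflection ip alpha \o w)%VF) \1%VF d.

Definition weyl_group : set 'End(E) :=
  [set w | exists d : seq E,
     (forall alpha, alpha \in d -> root_set alpha) /\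
     w = refl_prod killing_dual d].

Record is_weyl_invariant_inner_product ip : Prop := {
  ip_linear : forall alpha, linear (ip alpha : E -> R^o);
  ip_sym : forall alpha beta, ip alpha beta = ip beta alpha;
  ip_pos : forall alpha, alpha != 0 -> 0 < ip alpha alpha;
  ip_invariant : forall w alpha beta, weyl_group w ->
    ip (w alpha) (w beta) = ip alpha beta
}.

Section Simple.
Variables (n : nat) (Sigma : n.-tuple E).

Definition is_simple_system :=
  [/\ forall delta, delta \in Sigma -> root_set delta,
      basis_of fullv Sigma &
      forall alpha, root_set alpha -> exists c : 'I_n -> int,
        alpha = \sum_(i < n) (c i)%:~R *: tnth Sigma i /\
        ((forall i, 0 <= c i) \/ (forall i, c i <= 0))].

Definition pos_roots : set E :=
  [set alpha | root_set alpha /\ forall i, 0 <= coord Sigma i alpha].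

Definition neg_roots : set E :=
  [set alpha | root_set alpha /\ forall i, coord Sigma i alpha <= 0].

Definition height alpha : R := \sum_(i < n) coord Sigma i alpha.

Definition inversion_roots (w : 'End(E)) : set E :=
  pos_roots `&` [set w alpha | alpha in neg_roots].

Definition phi (w : 'End(E)) : E :=
  \sum_(delta \in inversion_roots w) (\dim (root_space delta))%:R *: delta.

Variable ip : E -> E -> R.

Definition is_simple_word (d : seq E) := {subset d <= Sigma}.

Definition weyl_length (w : 'End(E)) : nat :=
  xget 0%N [set l |
    (exists d, [/\ is_simple_word d, w = refl_prod ip d & size d = l]) /\
    (forall d, is_simple_word d -> w = refl_prod ip d -> (l <= size d)%N)].

Definition is_reduced_decomposition (w : 'End(E)) (d : seq E) :=
  [/\ is_simple_word d, w = refl_prod ip d & size d = weyl_length w].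

Inductive bruhat_le (v : 'End(E)) : 'End(E) -> Prop :=
| bruhat_refl : bruhat_le v v
| bruhat_step w alpha : bruhat_le v w -> root_set alpha ->
    (weyl_length w < weyl_length (reflection ip alpha \o w)%VF)%N ->
    bruhat_le v (reflection ip alpha \o w)%VF.

Definition covers (w w' : 'End(E)) :=
  bruhat_le w' w /\ weyl_length w = (weyl_length w').+1.

(* When w covers w', the root beta below is unique, hence so is the integer. *)
Definition kappa (w w' : 'End(E)) : int :=
  xget 0 [set m : int | exists beta : E,
    [/\ pos_roots beta, w = (reflection ip beta \o w')%VF &
        phi w - phi w' = m%:~R *: beta]].

End Simple.
End Roots.

(* Main.v *)
(** With sl2-triples (e, f, h) built from a root vector and its image under the
    Cartan involution, the roots of a split real form are stable under the
    reflections, no integer multiple n alpha (n > 1) of a root is a root, and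
    the root spaces are lines; moreover a W-invariant inner product defines the
    same reflections as the Killing form.  Let rho satisfy <delta^vee, rho> = 1 for every simple
    root delta.  For a reduced word the inversions of w = s_1 ... s_l are the
    distinct roots s_1 ... s_(k-1) (delta_k), and their sum telescopes to
    phi(w) = rho - w rho.  Hence phi(w) - phi(w') = w' (rho - s_gamma rho)
    = <gamma^vee, rho> w' gamma, where w' gamma = beta, and <., rho> is the
    height on the dual root system. *)

Require Import Defs.
From HB Require Import structures.
From mathcomp Require Import all_boot all_order all_algebra.
From mathcomp Require Import all_classical reals.
From mathcomp Require Import ring lra zify.

Set Implicit Arguments.
Unset Strict Implicit.
Unset Printing Implicit Defensive.

Import Order.TTheory GRing.Theory Num.Theory passmx.
Local Open Scope ring_scope.

(** Distinct eigenvalues are distinct roots of the characteristic polynomial, whose degree is the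
    dimension. This is what stops a chain of weight vectors. *)
Lemma size_eigenvalues (F : fieldType) (V : vectType F) (f : 'End(V))
    (s : seq F) :
  uniq s -> (forall a, a \in s -> exists2 v, v != 0 & f v = a *: v) ->
  (size s <= \dim {:V})%N.
Proof.
move=> s_uniq s_eig; pose A := mxof (vbasis {:V}) (vbasis {:V}) f.
have basisV := vbasisP {:V}.
have s_root : all (root (char_poly A)) s.
  apply/allP => a /s_eig [v v0 fv]; rewrite -eigenvalue_root_char.
  apply/eigenvalueP; exists (rVof (vbasis {:V}) v).
    by rewrite /A -rVof_app // fv linearZ.
  by rewrite rVof_eq0.
rewrite -ltnS -(size_char_poly A); apply: max_poly_roots => //.
by rewrite -size_poly_gt0 size_char_poly.
Qed.

(** * Bilinearity of the bracket and invariance of the Killing form *)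

Section LieBracket.
Variables (F : fieldType) (g : lieVectType F).
Implicit Types x y z : g.

Lemma lieDl x y z : lie (x + y) z = lie x z + lie y z.
Proof. by have /= := lie_linear_l z 1 x y; rewrite !scale1r. Qed.

Lemma lieZl c x z : lie (c *: x) z = c *: lie x z.
Proof.
have l0 : lie 0 z = 0.
  by apply: (addrI (lie 0 z)); rewrite -lieDl !addr0.
by have /= := lie_linear_l z c x 0; rewrite !addr0 l0 addr0.
Qed.

Lemma lieDr x y z : lie x (y + z) = lie x y + lie x z.
Proof. exact: linearD. Qed.

Lemma lieZr c x z : lie x (c *: z) = c *: lie x z.
Proof. exact: linearZ. Qed.

Lemma lieNl x z : lie (- x) z = - lie x z.
Proof. by rewrite -scaleN1r lieZl scaleN1r. Qed.

Lemma lieNr x z : lie x (- z) = - lie x z.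
Proof. exact: linearN. Qed.

Lemma lie0r x : lie x 0 = 0.
Proof. exact: linear0. Qed.

Lemma lieC x y : lie x y = - lie y x.
Proof.
apply/eqP; rewrite -addr_eq0; apply/eqP.
have := lie_alternating (x + y).
by rewrite lieDl !lieDr !lie_alternating addr0 add0r.
Qed.

Lemma lie_derivation x y z :
  lie x (lie y z) = lie (lie x y) z + lie y (lie x z).
Proof.
have /eqP := lie_jacobi x y z; rewrite -addrA addr_eq0 => /eqP ->.
by rewrite opprD addrC -lieC (lieC z x) lieNr opprK.
Qed.

Lemma adE x y : ad x y = lie x y.
Proof. exact: lfunE. Qed.

Lemma adD x y : ad (x + y) = ad x + ad y.
Proof. by apply/lfunP => z; rewrite add_lfunE !adE lieDl. Qed.

Lemma adZ c x : ad (c *: x) = c *: ad x.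
Proof. by apply/lfunP => z; rewrite scale_lfunE !adE lieZl. Qed.

Lemma ad_lie x y : ad (lie x y) = ((ad x \o ad y) - (ad y \o ad x))%VF.
Proof.
apply/lfunP => z; rewrite add_lfunE opp_lfunE !comp_lfunE !adE.
by rewrite (lie_derivation x y z) addrK.
Qed.

Lemma lfun_traceD (V : vectType F) (f h : 'End(V)) :
  lfun_trace (f + h) = lfun_trace f + lfun_trace h.
Proof. by rewrite /lfun_trace !linearD. Qed.

Lemma lfun_traceZ (V : vectType F) c (f : 'End(V)) :
  lfun_trace (c *: f) = c * lfun_trace f.
Proof. by rewrite /lfun_trace !linearZ. Qed.

Lemma lfun_traceC (V : vectType F) (f h : 'End(V)) :
  lfun_trace (f \o h)%VF = lfun_trace (h \o f)%VF.
Proof.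
rewrite /lfun_trace !(mxof_comp _ _ (vbasisP {:V})).
exact: mxtrace_mulC.
Qed.

Lemma killingC x y : killing x y = killing y x.
Proof. exact: lfun_traceC. Qed.

Lemma killingDl x y z : killing (x + y) z = killing x z + killing y z.
Proof. by rewrite /killing adD comp_lfunDl lfun_traceD. Qed.

Lemma killingZl c x z : killing (c *: x) z = c * killing x z.
Proof. by rewrite /killing adZ -comp_lfunZl lfun_traceZ. Qed.

Lemma killing0l z : killing 0 z = 0.
Proof. by rewrite -(scale0r z) killingZl mul0r. Qed.

Lemma killingDr x y z : killing x (y + z) = killing x y + killing x z.
Proof. by rewrite killingC killingDl !(killingC _ x). Qed.

Lemma killingZr c x z : killing x (c *: z) = c * killing x z.
Proof. by rewrite killingC killingZl killingC. Qed.

(** Each [ad] of a bracket is a commutator; after expansion the two sides differ by a cyclic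
    permutation under the trace. *)
Lemma killing_invariant x y z : killing (lie x y) z = killing x (lie y z).
Proof.
rewrite /killing !ad_lie comp_lfunDl comp_lfunDr !lfun_traceD.
rewrite comp_lfunNl comp_lfunNr -!scaleN1r !lfun_traceZ.
by rewrite -!comp_lfunA (lfun_traceC (ad y)) -!comp_lfunA.
Qed.

End LieBracket.

(** * Weight vectors for sl2-triples acting by the bracket *)

Section Sl2.
Variables (R : realType) (g : lieVectType R).
Implicit Types (x y v : g) (m : R).

Record sl2_triple (e f h : g) : Prop := Sl2Triple {
  sl2_he : lie h e = 2 *: e;
  sl2_hf : lie h f = - 2 *: f;
  sl2_ef : lie e f = h
}.

Lemma sl2_swap e f h : sl2_triple e f h -> sl2_triple f e (- h).
Proof.
case=> he hf ef; split; rewrite ?lieNl ?he ?hf ?scaleNr ?opprK //.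
by rewrite lieC ef.
Qed.

Section Triple.
Variables (e f h : g).
Hypothesis t : sl2_triple e f h.

Lemma weight_f v m j :
  lie h v = m *: v ->
  lie h (iter j (lie f) v) = (m - 2 * j%:R) *: iter j (lie f) v.
Proof.
move=> hv; elim: j => [|j IH]; first by rewrite mulr0 subr0.
rewrite iterS lie_derivation (sl2_hf t) IH lieZl lieZr -scalerDl.
by congr (_ *: _); rewrite -[in RHS]natr1; ring.
Qed.

(** Moving [e] past each [f] leaves one [h]; the coefficient is the sum of the weights [m - 2 i] for
    [i <= j]. *)
Lemma e_iter_f v m j :
  lie h v = m *: v -> lie e v = 0 ->
  lie e (iter j.+1 (lie f) v) = (j.+1%:R * (m - j%:R)) *: iter j (lie f) v.
Proof.
move=> hv ev; elim: j => [|j IH].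
  by rewrite /= lie_derivation (sl2_ef t) hv ev lie0r addr0 subr0 mul1r.
rewrite iterS lie_derivation (sl2_ef t) (weight_f _ hv) IH lieZr -scalerDl.
by congr (_ *: _); rewrite -!natr1; ring.
Qed.

(** As long as they are nonzero, the iterates are eigenvectors of [ad h] for the distinct
    eigenvalues [m - 2 j], and only [\dim {:g}] of these can exist. *)
Lemma f_nilpotent v m : lie h v = m *: v -> exists j, iter j (lie f) v == 0.
Proof.
move=> hv; pose s := [seq m - 2 * j%:R | j <- iota 0 (\dim {:g}).+1].
case: (boolP (has (fun j => iter j (lie f) v == 0) (iota 0 (\dim {:g}).+1))).
  by case/hasP => j _ j0; exists j.
move=> /hasPn nz.
have s_uniq : uniq s.
  rewrite map_inj_uniq ?iota_uniq // => i j /addrI /oppr_inj.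
  by move/mulfI => /(_ (lt0r_neq0 (ltr0Sn _ _)))/eqP; rewrite eqr_nat => /eqP.
have : (size s <= \dim {:g})%N.
  apply: (@size_eigenvalues _ _ (ad h)) => // a /mapP [j /nz j0 ->].
  by exists (iter j (lie f) v) => //; rewrite adE (weight_f _ hv).
by rewrite size_map size_iota ltnn.
Qed.

(** Let [q.+1] be the first power of [f] that kills [v]. Applying [e] to that zero vector gives
    [(q + 1) (m - q) = 0]. *)
Lemma highest_weight v m :
  v != 0 -> lie h v = m *: v -> lie e v = 0 ->
  exists q : nat, m = q%:R /\
    forall j, (j <= q)%N -> iter j (lie f) v != 0.
Proof.
move=> v0 hv ev; have exj := f_nilpotent hv.
case: (ex_minnP exj) => -[|q] vq minq; first by rewrite (negPf v0) in vq.
have nz j : (j <= q)%N -> iter j (lie f) v != 0.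
  by move=> jq; apply/negP => /minq; rewrite ltnNge jq.
exists q; split => //.
have /eqP := e_iter_f q hv ev; rewrite (eqP vq) lie0r eq_sym.
rewrite scaler_eq0 (negPf (nz q (leqnn _))) orbF mulf_eq0 pnatr_eq0 /=.
by rewrite subr_eq0 => /eqP.
Qed.

End Triple.

(** By [sl2_swap], [e] is the lowering operator of the triple [(f, e, - h)], so [f_nilpotent] also
    bounds the powers of [e]. *)
Lemma raise_to_top e f h v m :
  sl2_triple e f h -> v != 0 -> lie h v = m *: v ->
  exists p : nat, [/\ iter p (lie e) v != 0, lie e (iter p (lie e) v) = 0 &
    lie h (iter p (lie e) v) = (m + 2 * p%:R) *: iter p (lie e) v].
Proof.
move=> t v0 hv; have t' := sl2_swap t.
have hv' : lie (- h) v = (- m) *: v by rewrite lieNl hv scaleNr.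
case: (ex_minnP (f_nilpotent t' hv')) => -[|p] vp minp.
  by rewrite (negPf v0) in vp.
exists p; split; last 1 first.
- apply: oppr_inj; rewrite -lieNl (weight_f t' _ hv') -scaleNr.
  by congr (_ *: _); ring.
- by apply/negP => /minp; rewrite ltnn.
- exact/eqP.
Qed.

Lemma weight_int e f h v m :
  sl2_triple e f h -> v != 0 -> lie h v = m *: v -> m \is a Num.int.
Proof.
move=> t v0 hv; have [p [vp evp hvp]] := raise_to_top t v0 hv.
have [q [mq _]] := highest_weight t vp hvp evp.
have -> : m = q%:R - (2 * p)%:R by rewrite natrM -mq; ring.
by rewrite rpredB ?natr_int.
Qed.

(** The vector obtained has the opposite weight [m + 2 p - 2 j = - m]. It is nonzero because [j]
    does not exceed the highest weight [m + 2 p]. *)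
Lemma reflect_weight_pos e f h v m :
  sl2_triple e f h -> v != 0 -> lie h v = m *: v -> 0 <= m ->
  exists p j : nat,
    j%:R = p%:R + m /\ iter j (lie f) (iter p (lie e) v) != 0.
Proof.
move=> t v0 hv m0; have [p [vp evp hvp]] := raise_to_top t v0 hv.
have [q [mq nz]] := highest_weight t vp hvp evp.
have pq : (p <= q)%N.
  have : p%:R <= q%:R :> R by rewrite -mq; have := ler0n R p; lra.
  by rewrite ler_nat.
exists p, (q - p)%N; split; last exact/nz/leq_subr.
by rewrite natrB // -mq; ring.
Qed.

End Sl2.

(** * Brackets of root vectors *)

Section RootSpaces.
Variables (R : realType) (g : lieVectType R) (a : {vspace g}).
Implicit Types (alpha beta : dual_space R a) (x y : g).

Lemma lie_root_space alpha beta x y :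
  x \in root_space alpha -> y \in root_space beta ->
  lie x y \in root_space (alpha + beta).
Proof.
move=> /mem_root_space hx /mem_root_space hy; apply/mem_root_space => h.
by rewrite lie_derivation hx hy lieZl lieZr -scalerDl add_lfunE.
Qed.

Lemma iter_root_space alpha beta x y n :
  x \in root_space alpha -> y \in root_space beta ->
  iter n (lie x) y \in root_space (beta + n%:R *: alpha).
Proof.
move=> hx hy; elim: n => [|n IH]; first by rewrite scale0r addr0.
by rewrite iterS -natr1 scalerDl scale1r addrA addrC lie_root_space.
Qed.

Lemma root_space_nz alpha x : x \in root_space alpha -> x != 0 ->
  root_space alpha != 0%VS.
Proof.
by move=> xin; apply: contra_neq => a0; move: xin; rewrite a0 memv0 => /eqP.
Qed.

End RootSpaces.

(** * Roots of a split real form: sl2-triples, reflections, root lines, reducedness *)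

Section SplitRealForm.
Variables (R : realType) (g : lieVectType R) (k s a : {vspace g}).
Hypothesis split_g : is_split_real_form k s a.
Local Notation E := (dual_space R a).
Implicit Types (alpha beta : E) (x y : g) (h t : subvs_of a).

Lemma killing_pos t : t != 0 -> 0 < killing (vsval t) (vsval t).
Proof.
have [_ _ _ _ [_ pos]] := split_cartan_decomposition split_g.
have [/subvP sub _ _] := split_maximal_abelian split_g.
move=> t0; apply: pos; first exact/sub/subvsP.
by rewrite -(inj_eq subvs_inj) linear0 in t0.
Qed.

Lemma killing_inj t t' :
  (forall h, killing (vsval t) (vsval h) = killing (vsval t') (vsval h)) ->
  t = t'.
Proof.
move=> eqK; apply/eqP; rewrite -subr_eq0; apply/negPn/negP => /killing_pos.
have {1}-> : vsval (t - t') = vsval t + (-1) *: vsval t'.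
  by rewrite linearB scaleN1r.
by rewrite killingDl killingZl eqK mulN1r subrr ltxx.
Qed.

Lemma killing_vecE alpha t :
  (forall h, killing (vsval t) (vsval h) = alpha h) -> killing_vec alpha = t.
Proof.
move=> tP; apply: xget_unique => // t' t'P.
by apply: killing_inj => h; rewrite tP t'P.
Qed.

(** Such an [x] normalizes [a], and a Cartan subalgebra is its own normalizer. This is where
    splitness enters. *)
Lemma centralizer_sub x : (forall h, lie (vsval h) x = 0) -> x \in a.
Proof.
have [_ _ self_norm] := split_cartan_subalgebra split_g => cx.
apply: self_norm => y ya; rewrite lieC -(vsprojK ya) cx oppr0.
exact: mem0v.
Qed.

(* For x = x_k + x_s the witness is x_k - x_s, the image of x under the Cartan
   involution. *)
Lemma opposite_root_vector alpha x :
  x \in root_space alpha -> x != 0 ->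
  exists2 y, y \in root_space (- alpha) & killing x y < 0.
Proof.
have [[ks_full ks0] kk ksub ss [kneg spos]] :=
  split_cartan_decomposition split_g.
have [/subvP a_s _ _] := split_maximal_abelian split_g.
move=> /mem_root_space hx x0.
have : x \in (k + s)%VS by rewrite ks_full memvf.
case/memv_addP => xk xkk [xs xss xE].
have swap h : lie (vsval h) xk = (alpha h : R) *: xs /\
    lie (vsval h) xs = (alpha h : R) *: xk.
  have hs : vsval h \in s by exact/a_s/subvsP.
  have eqh : lie (vsval h) xk - (alpha h : R) *: xs =
      (alpha h : R) *: xk - lie (vsval h) xs.
    have := hx h; rewrite xE lieDr scalerDr => /(canRL (addrK _)) ->.
    by rewrite addrAC addrK.
  (* The left side of [eqh] lies in [s] and the right side in [k], so both vanish: up to the factor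
     [alpha h], [ad h] exchanges the two components of [x]. *)
  have : lie (vsval h) xk - (alpha h : R) *: xs \in (k :&: s)%VS.
    rewrite memv_cap {1}eqh !memvB ?memvZ ?ss //.
    by rewrite lieC memvN ksub.
  rewrite ks0 memv0 => /eqP d0; split; apply/eqP; rewrite -subr_eq0.
    by rewrite d0.
  by rewrite -oppr_eq0 opprB -eqh d0.
exists (xk - xs).
  apply/mem_root_space => h; have [hk hs] := swap h.
  by rewrite lieDr lieNr hk hs opp_lfunE scaleNr scalerBr opprB.
have -> : killing x (xk - xs) = killing xk xk - killing xs xs.
  rewrite xE -[- xs]scaleN1r killingDl !killingDr !killingZr (killingC xs xk).
  ring.
have [xk0|xk0] := eqVneq xk 0.
  have xs0 : xs != 0 by apply: contra_neq x0 => xs0; rewrite xE xk0 xs0 addr0.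
  have := spos _ xss xs0; rewrite xk0 killing0l sub0r.
  by rewrite oppr_lt0.
have kn := kneg _ xkk xk0.
have [xs0|xs0] := eqVneq xs 0.
  by rewrite xs0 killing0l subr0.
by have := spos _ xss xs0; lra.
Qed.

(** [rt_coroot] turns pairing with the Killing coroot into evaluation at [h]; [rt_bracket] is what
    will force the root space to be a line. *)
Record root_triple alpha (e f : g) (h : subvs_of a) : Prop := RootTriple {
  rt_sl2 : sl2_triple e f (vsval h);
  rt_e : e \in root_space alpha;
  rt_e_neq0 : e != 0;
  rt_f : f \in root_space (- alpha);
  rt_h : alpha h = 2 :> R;
  rt_coroot beta : killing_dual (coroot (@killing_dual R g a) alpha) beta =
    beta h;
  rt_bracket y : y \in root_space alpha ->
    exists r : R, lie y f = r *: vsval h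
}.

Lemma root_tripleP alpha : root_set alpha ->
  exists e f h, root_triple alpha e f h.
Proof.
case=> alpha0 galpha0; pose e := vpick (root_space alpha).
have e0 : e != 0 by rewrite vpick0.
have eP : e \in root_space alpha by exact: memv_pick.
have [y yP Kneg] := opposite_root_vector eP e0.
(* The bracket has weight zero, so it centralizes [a]. *)
have brP z : z \in root_space alpha -> lie z y \in a.
  move=> zP; apply: centralizer_sub => h.
  have /mem_root_space -> := lie_root_space zP yP.
  by rewrite subrr zero_lfunE scale0r.
have brK z h : z \in root_space alpha ->
    killing (lie z y) (vsval h) = alpha h * killing z y.
  move=> zP; rewrite killing_invariant lieC.
  move/mem_root_space: yP => ->.
  by rewrite opp_lfunE scaleNr opprK killingZr.
pose c := killing e y; have c0 : c != 0 by rewrite ltr0_neq0.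
(* By invariance, pairing [lie e y] with [h] gives [alpha h * c], so [T] represents [alpha] for the
   Killing form. *)
pose T : subvs_of a := c^-1 *: vsproj a (lie e y).
have TE : vsval T = c^-1 *: lie e y by rewrite linearZ /= vsprojK ?brP.
have TK h : killing (vsval T) (vsval h) = alpha h.
  by rewrite TE killingZl brK // mulrCA mulVf ?mulr1.
have brT z : z \in root_space alpha -> lie z y = killing z y *: vsval T.
  move=> zP; rewrite -(vsprojK (brP z zP)) -linearZ; congr vsval.
  apply: killing_inj => h; rewrite vsprojK ?brP // brK // linearZ /=.
  by rewrite killingZl TK mulrC.
have T0 : T != 0.
  apply: contra_neq alpha0 => T0; apply/lfunP => h; rewrite -TK T0 zero_lfunE.
  by rewrite linear0 killing0l.
pose N : R := alpha T; have N_gt0 : 0 < N by rewrite /N -TK killing_pos.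
have N0 : N != 0 by rewrite gt_eqF.
have hE : alpha ((2 / N) *: T) = 2 :> R.
  by rewrite linearZ /= -/N; exact: divfK.
(* Since [alpha T = N] and [lie e y = c *: T], these scalars give [alpha h = 2] and
   [lie e f = h]. *)
exists e, ((2 / N / c) *: y), ((2 / N) *: T); split => //.
- split.
  + by move/mem_root_space: eP => ->; rewrite hE.
  + have fP : (2 / N / c) *: y \in root_space (- alpha) by rewrite memvZ.
    by move/mem_root_space: fP => ->; rewrite opp_lfunE hE.
  + by rewrite lieZr brT // scalerA divfK // linearZ.
- by rewrite memvZ.
- move=> beta; rewrite /killing_dual; congr (beta _).
  apply: killing_vecE => h; rewrite /coroot /killing_dual.
  by rewrite (killing_vecE TK) scale_lfunE linearZ /= killingZl TK.
- move=> z zP; exists (killing z y / c).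
  rewrite lieZr brT // linearZ /= !scalerA; congr (_ *: _); ring.
Qed.

Lemma reflection_killingE alpha beta e f h : root_triple alpha e f h ->
  reflection (@killing_dual R g a) alpha beta = beta - (beta h : R) *: alpha.
Proof.
move=> t; rewrite /reflection.
under eq_fun do rewrite (rt_coroot t).
have lin : linear (fun b : E => b - (b h : R) *: alpha).
  move=> c b b'; rewrite add_lfunE scale_lfunE scalerDl opprD scalerBr.
  by rewrite scalerA addrACA.
pose L : {linear E -> E} := HB.pack (fun b : E => b - (b h : R) *: alpha)
  (GRing.isLinear.Build R _ _ _ _ lin).
exact: (lfunE L).
Qed.

(** A root vector for [beta] has weight [beta h] under the triple. The nonzero vector of opposite
    weight supplied by [reflect_weight_pos] lies in the root space of the reflected form; a negative
    weight is handled by the swapped triple. *)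
Lemma root_reflect alpha beta e f h : root_triple alpha e f h ->
  root_set beta -> root_set (beta - (beta h : R) *: alpha).
Proof.
move=> t [beta0 gbeta0]; split.
  (* If [beta = beta h *: alpha], evaluation at [h] gives [beta h = 2 * beta h], hence
     [beta = 0]. *)
  apply: contra_neq beta0 => /eqP; rewrite subr_eq0 => /eqP betaE.
  have b0 : (beta h : R) == 0.
    have : (beta h : R) == beta h * 2.
      by apply/eqP; rewrite {1}betaE scale_lfunE (rt_h t).
    by rewrite mulr_natr -subr_eq0 opprD addNKr oppr_eq0.
  by rewrite betaE (eqP b0) scale0r.
have [eP fP] := (rt_e t, rt_f t).
pose y := vpick (root_space beta).
have y0 : y != 0 by rewrite vpick0.
have yP : y \in root_space beta by exact: memv_pick.
have hy : lie (vsval h) y = (beta h : R) *: y.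
  by move/mem_root_space: yP => ->.
have [b0|b0] := leP 0 (beta h : R).
  have [p [j [jE nz]]] := reflect_weight_pos (rt_sl2 t) y0 hy b0.
  apply: root_space_nz nz.
  have := iter_root_space j fP (iter_root_space p eP yP).
  by rewrite jE scalerN scalerDl opprD addrA addrK.
have hy' : lie (- vsval h) y = (- (beta h : R)) *: y.
  by rewrite lieNl hy scaleNr.
have b0' : 0 <= - (beta h : R) by rewrite oppr_ge0 ltW.
have [p [j [jE nz]]] := reflect_weight_pos (sl2_swap (rt_sl2 t)) y0 hy' b0'.
apply: root_space_nz nz.
have := iter_root_space j eP (iter_root_space p fP yP).
by rewrite jE scalerN scalerDl addrA subrK scaleNr.
Qed.

Lemma root_int alpha beta e f h : root_triple alpha e f h ->
  root_set beta -> (beta h : R) \is a Num.int.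
Proof.
move=> t [beta0 gbeta0]; pose y := vpick (root_space beta).
have y0 : y != 0 by rewrite vpick0.
apply: (weight_int (rt_sl2 t) y0).
by have /mem_root_space := memv_pick (root_space beta); apply.
Qed.

(** Subtracting a multiple of [e] from [y] leaves a vector [z] killed by [f]. For the swapped triple
    a nonzero [z] would have highest weight -2, but highest weights are natural numbers. *)
Lemma root_space_line alpha e f h : root_triple alpha e f h ->
  root_space alpha = <[e]>%VS.
Proof.
move=> t; apply/eqP; rewrite eqEsubv -memvE (rt_e t) andbT.
apply/subvP => y yP; have [r yf] := rt_bracket t yP.
pose z := y - r *: e.
have zP : z \in root_space alpha by rewrite memvB ?memvZ ?(rt_e t).
have zf : lie f z = 0.
  rewrite lieC lieDl -scaleNr lieZl yf (sl2_ef (rt_sl2 t)) scaleNr subrr.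
  by rewrite oppr0.
have hz : lie (- vsval h) z = - 2 *: z.
  by rewrite lieNl scaleNr; move/mem_root_space: zP => ->; rewrite (rt_h t).
have [z0|z0] := eqVneq z 0; last first.
  have [q [qE _]] := highest_weight (sl2_swap (rt_sl2 t)) z0 hz zf.
  by have := ler0n R q; rewrite -qE; lra.
by apply/vlineP; exists r; apply/eqP; rewrite -subr_eq0 -/z z0.
Qed.

Lemma dim_root_space alpha : root_set alpha -> \dim (root_space alpha) = 1%N.
Proof.
move=> /root_tripleP [e [f [h t]]].
by rewrite (root_space_line t) dim_vline (rt_e_neq0 t).
Qed.

(* A root vector for n * alpha generates an sl2-module of highest weight 2 m
   with m >= n; lowering m - 1 times lands in the line g_alpha = R e, which e
   kills, whereas e acts injectively on that weight space of the module. *)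
Lemma root_reduced alpha n : root_set alpha -> (1 < n)%N ->
  ~ root_set (n%:R *: alpha).
Proof.
move=> /root_tripleP [e [f [h t]]] n1 [_ gn].
have [eP fP] := (rt_e t, rt_f t).
pose y := vpick (root_space (n%:R *: alpha)).
have y0 : y != 0 by rewrite vpick0.
have yP : y \in root_space (n%:R *: alpha) by exact: memv_pick.
have hy : lie (vsval h) y = (n%:R * 2) *: y.
  by move/mem_root_space: yP => ->; rewrite scale_lfunE (rt_h t).
have [p [vp evp hvp]] := raise_to_top (rt_sl2 t) y0 hy.
have [q [qE nz]] := highest_weight (rt_sl2 t) vp hvp evp.
have := iter_root_space p eP yP; set v := iter p _ y in vp evp hvp nz * => vP.
(* From here the old [n] reads [n.+2], so the top weight is [2 (n + p + 2)] and [(n + p).+1]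
   lowerings reach the root [alpha]. *)
case: n => [|[|n]] // in n1 gn y y0 yP hy v vp evp hvp qE nz vP *.
have qn : q = ((n + p).+2 * 2)%N.
  apply/eqP; rewrite -(eqr_nat R) -qE natrM -!natr1 natrD; apply/eqP; ring.
have le1 : ((n + p).+1 <= q)%N by rewrite qn; lia.
have := e_iter_f (rt_sl2 t) (n + p) hvp evp.
have /vlineP [r ->] : iter (n + p).+1 (lie f) v \in <[e]>%VS.
  rewrite -(root_space_line t).
  have := iter_root_space (n + p).+1 fP vP.
  congr (_ \in root_space _).
  rewrite scalerN -scalerDl -scalerBl -[RHS]scale1r; congr (_ *: _).
  by rewrite -!natr1 natrD; ring.
rewrite lieZr lie_alternating scaler0 => /esym/eqP.
rewrite scaler_eq0 (negPf (nz _ _)) ?orbF; last by rewrite ltnW.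
rewrite mulf_eq0 pnatr_eq0 /= qE subr_eq0 eqr_nat qn => /eqP; lia.
Qed.

End SplitRealForm.

(** * Reflections for an invariant inner product, and words in them *)

Section WeylInvariantProduct.
Variables (R : realType) (g : lieVectType R) (k s a : {vspace g}).
Hypothesis split_g : is_split_real_form k s a.
Local Notation E := (dual_space R a).
Variable ip : E -> E -> R.
Hypothesis ip_inv : is_weyl_invariant_inner_product ip.
Implicit Types (alpha beta x y : E) (d : seq E) (v w : 'End(E)).

Lemma ipDr x y z : ip x (y + z) = ip x y + ip x z.
Proof. by have := ip_linear ip_inv x 1 y z; rewrite !scale1r. Qed.

Lemma ip0r x : ip x 0 = 0.
Proof. by apply: (addrI (ip x 0)); rewrite -ipDr !addr0. Qed.

Lemma ipZr c x y : ip x (c *: y) = c * ip x y.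
Proof. by have := ip_linear ip_inv x c y 0; rewrite !addr0 ip0r addr0. Qed.

Lemma ipNr x y : ip x (- y) = - ip x y.
Proof. by rewrite -scaleN1r ipZr mulN1r. Qed.

Lemma ipZl c x y : ip (c *: x) y = c * ip x y.
Proof. by rewrite (ip_sym ip_inv) ipZr (ip_sym ip_inv). Qed.

Lemma ip_sumr (I : Type) (r : seq I) (F : I -> E) x :
  ip x (\sum_(i <- r) F i) = \sum_(i <- r) ip x (F i).
Proof.
by elim: r => [|i r IH]; rewrite ?big_nil ?ip0r // !big_cons ipDr IH.
Qed.

Lemma ip_eq0 x : (ip x x == 0) = (x == 0).
Proof.
have [->|x0] := eqVneq x 0; first by rewrite ip0r eqxx.
by rewrite gt_eqF // (ip_pos ip_inv).
Qed.

Lemma reflectionE alpha x :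
  reflection ip alpha x = x - ip (coroot ip alpha) x *: alpha.
Proof.
have lin : linear (fun x => x - ip (coroot ip alpha) x *: alpha).
  move=> c y z; rewrite ipDr ipZr scalerDl opprD scalerBr.
  by rewrite scalerA addrACA.
pose L : {linear E -> E} :=
  HB.pack (fun x => x - ip (coroot ip alpha) x *: alpha)
    (GRing.isLinear.Build R _ _ _ _ lin).
exact: (lfunE L).
Qed.

Lemma ip_coroot_self alpha : alpha != 0 -> ip (coroot ip alpha) alpha = 2.
Proof. by move=> a0; rewrite ipZl divfK // ip_eq0. Qed.

Lemma reflection_self alpha : alpha != 0 -> reflection ip alpha alpha = - alpha.
Proof.
move=> a0; rewrite reflectionE ip_coroot_self // scaler_nat mulr2n opprD.
by rewrite addNKr.
Qed.

Lemma reflectionK alpha : alpha != 0 -> involutive (reflection ip alpha).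
Proof.
move=> a0 x; rewrite [reflection ip alpha x]reflectionE linearB linearZ /=.
rewrite reflection_self //.
by rewrite reflectionE scalerN opprK subrK.
Qed.

Lemma reflection_isometry alpha x y : alpha != 0 ->
  ip (reflection ip alpha x) (reflection ip alpha y) = ip x y.
Proof.
move=> a0; have N0 : ip alpha alpha != 0 by rewrite ip_eq0.
rewrite !reflectionE ipDr ipNr ipZr !(ip_sym ip_inv (x - _)).
rewrite !ipDr !ipNr !ipZr !ipZl (ip_sym ip_inv y x) (ip_sym ip_inv y alpha).
by field.
Qed.

(** The Killing reflection preserves [ip] and negates [alpha]; comparing [ip alpha beta] before and
    after gives [2 * ip alpha beta = beta h * ip alpha alpha]. Hence both forms define the same
    reflection in [alpha]. *)
Lemma pairing_root_triple alpha beta e f h : root_set alpha ->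
  root_triple alpha e f h ->
  ip (coroot ip alpha) beta = beta h.
Proof.
move=> ra t; pose sa := reflection (@killing_dual R g a) alpha.
have sE b : sa b = b - (b h : R) *: alpha := reflection_killingE b t.
have Wsa : weyl_group sa.
  exists [:: alpha]; split; last by rewrite /= comp_lfun1r.
  by move=> b; rewrite inE => /eqP ->.
have saa : sa alpha = - alpha.
  by rewrite sE (rt_h t) scaler_nat mulr2n opprD addNKr.
have a0 : ip alpha alpha != 0 by rewrite ip_eq0; case: ra.
have := ip_invariant ip_inv alpha beta Wsa.
rewrite saa sE ipDr !ipNr ipZr (ip_sym ip_inv (- _)) ipNr.
rewrite (ip_sym ip_inv (- _)) ipNr (ip_sym ip_inv beta) => H.
have H2 : 2 * ip alpha beta = beta h * ip alpha alpha by lra.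
by rewrite ipZl mulrAC H2 mulfK.
Qed.

Lemma root_neq0 alpha : root_set alpha -> alpha != 0.
Proof. by case. Qed.

Lemma root_reflection alpha beta :
  root_set alpha -> root_set beta -> root_set (reflection ip alpha beta).
Proof.
move=> ra rb; have [e [f [h t]]] := root_tripleP split_g ra.
by rewrite reflectionE (pairing_root_triple _ ra t); exact: root_reflect t rb.
Qed.

Lemma root_reflectionE alpha beta :
  root_set alpha -> root_set (reflection ip alpha beta) -> root_set beta.
Proof.
move=> ra /(root_reflection ra).
by rewrite (reflectionK (root_neq0 ra)).
Qed.

Lemma root_set_opp alpha : root_set alpha -> root_set (- alpha).
Proof.
by move=> ra; rewrite -reflection_self ?root_neq0 //; apply: root_reflection.
Qed.

Lemma pairing_int alpha beta : root_set alpha -> root_set beta ->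
  ip (coroot ip alpha) beta \is a Num.int.
Proof.
move=> ra rb; have [e [f [h t]]] := root_tripleP split_g ra.
by rewrite (pairing_root_triple _ ra t); apply: root_int t rb.
Qed.

Definition ip_isometry w := forall x y, ip (w x) (w y) = ip x y.

Lemma isometry_lker0 w : ip_isometry w -> lker w == 0%VS.
Proof.
move=> iw; rewrite -subv0; apply/subvP => x; rewrite memv_ker memv0 => /eqP wx.
by rewrite -ip_eq0 -iw wx ip0r.
Qed.

Lemma coroot_isometry w alpha : ip_isometry w ->
  coroot ip (w alpha) = w (coroot ip alpha).
Proof. by move=> iw; rewrite /coroot iw linearZ. Qed.

Lemma reflection_conj w alpha : ip_isometry w ->
  (reflection ip (w alpha) \o w)%VF = (w \o reflection ip alpha)%VF.
Proof.
move=> iw; apply/lfunP => x; rewrite !comp_lfunE !reflectionE.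
by rewrite coroot_isometry // iw linearB [in RHS]linearZ.
Qed.

Lemma refl_prod_cat d1 d2 :
  refl_prod ip (d1 ++ d2) = (refl_prod ip d1 \o refl_prod ip d2)%VF.
Proof.
by elim: d1 => [|x d1 IH] /=; rewrite ?comp_lfun1l // IH comp_lfunA.
Qed.

Definition root_word d := forall x, x \in d -> root_set x.

Lemma root_word_cons x d : root_word (x :: d) -> root_set x /\ root_word d.
Proof.
move=> rd; split=> [|y yd]; first by apply: rd; rewrite mem_head.
by apply: rd; rewrite inE yd orbT.
Qed.

Lemma refl_prod_isometry d : root_word d -> ip_isometry (refl_prod ip d).
Proof.
elim: d => [|x d IH] /=; first by move=> _ y z; rewrite !id_lfunE.
move=> /root_word_cons [rx rd] y z.
by rewrite !comp_lfunE reflection_isometry ?root_neq0 // IH.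
Qed.

Lemma refl_prod_root d alpha : root_word d ->
  root_set (refl_prod ip d alpha) <-> root_set alpha.
Proof.
elim: d => [|x d IH] /=; first by rewrite id_lfunE.
move=> /root_word_cons [rx rd]; rewrite comp_lfunE -IH //.
by split; [apply: root_reflectionE | apply: root_reflection].
Qed.

(** The k-th entry is s_1 ... s_(k-1) applied to the k-th letter. *)
Fixpoint inversion_seq d : seq E :=
  if d is x :: d' then x :: map (reflection ip x) (inversion_seq d') else [::].

Lemma inversion_seq_root d : root_word d -> root_word (inversion_seq d).
Proof.
elim: d => [|x d IH] //= /root_word_cons [rx /IH rd] y.
by rewrite inE => /orP [/eqP -> //|/mapP [z /rd rz ->]]; apply: root_reflection.
Qed.

Lemma mem_inversion_seq d1 d2 x :
  refl_prod ip d1 x \in inversion_seq (d1 ++ x :: d2).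
Proof.
elim: d1 => [|y d1 IH] /=; first by rewrite id_lfunE mem_head.
by rewrite comp_lfunE inE map_f ?orbT.
Qed.

(* Reflecting in an entry of [inversion_seq d] deletes the corresponding letter
   of d: the exchange condition. *)
Lemma exchange d beta : root_word d -> beta \in inversion_seq d ->
  exists d', [/\ {subset d' <= d}, (size d' < size d)%N &
    refl_prod ip d' = (reflection ip beta \o refl_prod ip d)%VF].
Proof.
elim: d beta => [|x d IH] //= beta /root_word_cons [rx rd].
have x0 := root_neq0 rx.
rewrite inE => /orP [/eqP ->|/mapP [y /IH -/(_ rd) [d' [sub sz d'E]] ->]].
  exists d; split=> [y yd|//|]; first by rewrite inE yd orbT.
  by apply/lfunP => y; rewrite !comp_lfunE reflectionK.
exists (x :: d'); split=> //.
  by move=> z; rewrite !inE => /orP [->//|/sub ->]; rewrite orbT.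
have isox : ip_isometry (reflection ip x).
  by move=> y1 y2; apply: reflection_isometry.
by rewrite /= d'E !comp_lfunA reflection_conj.
Qed.

(** Since [rho] is sent to [rho - x] by the reflection in [x], a new first letter turns
    [rho - v rho] into [x + s_x (rho - v rho) = rho - s_x v rho]. *)
Lemma sum_inversion_seq d rho : root_word d ->
  (forall x, x \in d -> ip (coroot ip x) rho = 1) ->
  \sum_(x <- inversion_seq d) x = rho - refl_prod ip d rho.
Proof.
elim: d => [|x d IH] /=; first by rewrite big_nil id_lfunE subrr.
move=> /root_word_cons [rx rd] rhoP.
rewrite big_cons big_map -linear_sum /= IH //; last first.
  by move=> y yd; apply: rhoP; rewrite inE yd orbT.
rewrite comp_lfunE linearB /= [reflection ip x rho]reflectionE.
by rewrite rhoP ?mem_head // scale1r addrA [x + _]addrC subrK.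
Qed.

End WeylInvariantProduct.

(** * Simple systems: positivity, reduced words, inversions and rho *)

Section SimpleSystem.
Variables (R : realType) (g : lieVectType R) (k s a : {vspace g}).
Hypothesis split_g : is_split_real_form k s a.
Local Notation E := (dual_space R a).
Variable ip : E -> E -> R.
Hypothesis ip_inv : is_weyl_invariant_inner_product ip.
Variables (n : nat) (Sigma : n.-tuple E).
Hypothesis simple_Sigma : is_simple_system Sigma.
Implicit Types (alpha beta x y : E) (d : seq E) (v w : 'End(E)).

Let Sigma_root delta : delta \in Sigma -> root_set delta.
Proof. by case: simple_Sigma => H _ _; apply: H. Qed.

Let Sigma_basis : basis_of fullv Sigma.
Proof. by case: simple_Sigma. Qed.

Lemma simple_word_root d : is_simple_word Sigma d -> root_word d.
Proof. by move=> sd x /sd; apply: Sigma_root. Qed.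

Lemma simple_word_cons x d :
  is_simple_word Sigma (x :: d) -> x \in Sigma /\ is_simple_word Sigma d.
Proof.
move=> sd; split=> [|y yd]; first by apply: sd; rewrite mem_head.
by apply: sd; rewrite inE yd orbT.
Qed.

Lemma coord_simple i j : coord Sigma i (tnth Sigma j) = (i == j)%:R.
Proof.
by rewrite (tnth_nth 0) coord_free ?(basis_free Sigma_basis) // eq_sym.
Qed.

Lemma root_coord_int alpha i : root_set alpha ->
  coord Sigma i alpha \is a Num.int.
Proof.
case: simple_Sigma => _ _ H /H [c [-> _]].
rewrite linear_sum rpred_sum // => j _.
by rewrite linearZ /= coord_simple rpredM ?intr_int ?natr_int.
Qed.

Lemma root_pos_or_neg alpha : root_set alpha ->
  pos_roots Sigma alpha \/ neg_roots Sigma alpha.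
Proof.
move=> ra; case: simple_Sigma => _ _ /(_ _ ra) [c [alphaE c_sign]].
have cE i : coord Sigma i alpha = (c i)%:~R.
  rewrite alphaE linear_sum (bigD1 i) //= linearZ /= coord_simple eqxx.
  rewrite big1 => [|j ji]; first by rewrite addr0; exact: mulr1.
  by rewrite linearZ /= coord_simple eq_sym (negPf ji); exact: mulr0.
by case: c_sign => Hc; [left | right]; split=> // i;
  rewrite cE ?ler0z ?lerz0.
Qed.

Lemma pos_not_neg alpha : pos_roots Sigma alpha -> ~ neg_roots Sigma alpha.
Proof.
move=> [[alpha0 _] pos] [_ neg]; case/eqP: alpha0.
rewrite (coord_basis Sigma_basis (memvf alpha)) big1 // => i _.
have -> : coord Sigma i alpha = 0.
  by apply/eqP; rewrite eq_le pos neg.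
by rewrite scale0r.
Qed.

Lemma pos_rootN alpha : neg_roots Sigma (- alpha) <-> pos_roots Sigma alpha.
Proof.
split=> -[ra H]; split=> [|i].
- by rewrite -[alpha]opprK; apply: (root_set_opp split_g ip_inv).
- by have := H i; rewrite linearN /= oppr_le0.
- exact: (root_set_opp split_g ip_inv).
- by rewrite linearN /= oppr_le0.
Qed.

Lemma simple_pos delta : delta \in Sigma -> pos_roots Sigma delta.
Proof.
move=> dS; split; first exact: Sigma_root.
by case/tnthP: dS => j -> i; rewrite coord_simple ler0n.
Qed.

(** The scalar is a coordinate of a root, hence a natural number; 0 is excluded because roots are
    nonzero, and larger values by reducedness. *)
Lemma root_multiple_simple delta c : delta \in Sigma -> 0 <= c ->
  root_set (c *: delta) -> c = 1.
Proof.
move=> dS c0 rc; have : c \is a Num.int.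
  case/tnthP: dS rc => j -> /(root_coord_int j).
  by rewrite linearZ /= coord_simple eqxx /GRing.scale /= mulr1.
rewrite intrEge0 // => /natrP [m cE]; rewrite cE in rc *.
case: m => [|[|m]] // in cE rc *.
  by case: rc => /eqP; rewrite scale0r.
by have := root_reduced split_g (Sigma_root dS) (isT : (1 < m.+2)%N).
Qed.

(** The reflection changes only the [delta] coordinate. A negative image would make all other
    coordinates of [beta] vanish, so [beta] would be a multiple of [delta], that is [delta]
    itself. *)
Lemma simple_reflection_pos delta beta : delta \in Sigma ->
  pos_roots Sigma beta -> beta != delta ->
  pos_roots Sigma (reflection ip delta beta).
Proof.
move=> dS [rb pos] bd; have rd := Sigma_root dS.
have := root_reflection split_g ip_inv rd rb.
case/root_pos_or_neg => // -[_ neg]; exfalso; move/eqP: bd; apply.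
have [j dE] := tnthP _ _ dS.
have coord0 i : i != j -> coord Sigma i beta = 0.
  move=> ij; apply/eqP; rewrite eq_le pos andbT; have := neg i.
  rewrite (reflectionE ip_inv) linearB linearZ /= dE coord_simple (negPf ij).
  by rewrite mulr0 subr0.
have betaE : beta = coord Sigma j beta *: delta.
  rewrite {1}(coord_basis Sigma_basis (memvf beta)) (bigD1 j) //=.
  rewrite big1 => [|i ij]; last by rewrite coord0 // scale0r.
  by rewrite addr0 dE (tnth_nth 0).
rewrite betaE (@root_multiple_simple delta (coord Sigma j beta)) ?scale1r //.
by rewrite -betaE.
Qed.

(** An inversion other than the first letter [x] stays positive under the reflection in [x], and so
    becomes an inversion of the shorter word. *)
Lemma inversion_roots_sub d beta : is_simple_word Sigma d ->
  inversion_roots Sigma (refl_prod ip d) beta -> beta \in inversion_seq ip d.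
Proof.
elim: d beta => [|x d IH] beta /=.
  move=> _ [pb [c nc]]; rewrite id_lfunE => cb; case: (pos_not_neg pb).
  by rewrite -cb.
move=> /simple_word_cons [xS sd] [pb [c nc]]; rewrite comp_lfunE => cb.
have x0 := root_neq0 (Sigma_root xS).
rewrite inE; have [//|bx /=] := eqVneq beta x.
have vc : refl_prod ip d c = reflection ip x beta.
  by rewrite -cb (reflectionK ip_inv).
rewrite -[beta](reflectionK ip_inv x0) map_f //; apply: IH => //.
split; last by exists c.
exact: simple_reflection_pos.
Qed.

(** Minimality stated without [weyl_length], which suits induction on the word. *)
Definition reduced_word d := is_simple_word Sigma d /\
  forall d', is_simple_word Sigma d' -> refl_prod ip d' = refl_prod ip d ->
    (size d <= size d')%N.

Lemma reduced_decomposition_word w d :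
  is_reduced_decomposition Sigma ip w d -> reduced_word d.
Proof.
case=> sd wE szE; split=> // d' sd' d'E.
pose P l := exists d,
  [/\ is_simple_word Sigma d, w = refl_prod ip d & size d = l].
(* A least length exists, so the [xget] in [weyl_length] does not fall back on its default 0. *)
have exP : exists l, `[< P l >] by exists (size d); apply/asboolP; exists d.
case: (ex_minnP exP) => m /asboolP Pm minm.
have := @xgetPex _ 0%N [set l | (exists d, [/\ is_simple_word Sigma d,
  w = refl_prod ip d & size d = l]) /\ (forall d, is_simple_word Sigma d ->
  w = refl_prod ip d -> (l <= size d)%N)]%classic.
case.
  exists m; split=> // d0 sd0 d0E; apply: minm; apply/asboolP.
  by exists d0.
by move=> _ /(_ d' sd'); rewrite -/(weyl_length Sigma ip w) -szE d'E; apply.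
Qed.

Lemma reduced_word_cons x d : reduced_word (x :: d) -> reduced_word d.
Proof.
move=> [/simple_word_cons [xS sd] min]; split=> // d' sd' d'E.
have := min (x :: d'); rewrite /= ltnS d'E; apply=> //.
by move=> y; rewrite inE => /orP [/eqP ->|/sd'].
Qed.

(** Otherwise [exchange] would delete a letter of [d] and express the product of [x :: d] by a word
    shorter than [d]. *)
Lemma reduced_head_notin x d :
  reduced_word (x :: d) -> x \notin inversion_seq ip d.
Proof.
move=> [/simple_word_cons [xS sd] min]; apply/negP.
case/(exchange ip_inv (simple_word_root sd)) => d' [sub sz d'E].
have := min d' (fun y yd => sd y (sub y yd)) d'E.
by rewrite /= ltnNge ltnW // ltnW.
Qed.

Lemma reduced_inversion_seq_pos d beta : reduced_word d ->
  beta \in inversion_seq ip d -> inversion_roots Sigma (refl_prod ip d) beta.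
Proof.
elim: d beta => [|x d IH] beta //= red.
have xnotin := reduced_head_notin red.
have [[/simple_word_cons [xS sd] _] /IH {}IH] := (red, reduced_word_cons red).
have rx := Sigma_root xS; have x0 := root_neq0 rx.
have rd := simple_word_root sd.
have iso := refl_prod_isometry ip_inv rd.
rewrite inE => /orP [/eqP ->|/mapP [y yin ->]].
  split; first exact: simple_pos.
  (* The preimage [c] of [x] under the tail must be positive: were it negative, [x] would be an
     inversion of the tail, against [xnotin]. Then [- c] witnesses that [x] is an inversion of the
     whole word. *)
  pose c := ((refl_prod ip d)^-1)%VF x.
  have cE : refl_prod ip d c = x.
    by rewrite /c lker0_lfunVK // (isometry_lker0 ip_inv).
  have rc : root_set c by rewrite -(refl_prod_root split_g ip_inv c rd) cE.
  exists (- c); last first.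
    rewrite comp_lfunE linearN /= cE linearN /=.
    by rewrite (reflection_self ip_inv) ?opprK.
  apply/pos_rootN; case: (root_pos_or_neg rc) => // nc; case/negP: xnotin.
  apply: inversion_roots_sub => //; split; first exact: simple_pos.
  by exists c.
have [py [c nc cE]] := IH y yin.
split; last by exists c => //; rewrite comp_lfunE cE.
by apply: simple_reflection_pos => //; apply: contraNneq xnotin => <-.
Qed.

Lemma reduced_inversion_seq_uniq d :
  reduced_word d -> uniq (inversion_seq ip d).
Proof.
elim: d => [|x d IH] //= red; have rd := reduced_word_cons red.
have [[/simple_word_cons [xS _] _] _] := (red, tt).
have rx := Sigma_root xS; have x0 := root_neq0 rx.
rewrite map_inj_uniq ?IH ?andbT //; last exact/inv_inj/(reflectionK ip_inv).
apply/negP => /mapP [y yin xE].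
have [py _] := reduced_inversion_seq_pos rd yin.
(* A repetition of the head [x] forces the entry [y] to be [- x], although entries for a reduced
   word are positive. *)
have yE : y = - x.
  by rewrite -[y](reflectionK ip_inv x0) -xE (reflection_self ip_inv).
apply: (pos_not_neg py); rewrite yE.
by apply/pos_rootN; apply: simple_pos.
Qed.

Lemma phi_reduced d : reduced_word d ->
  phi Sigma (refl_prod ip d) = \sum_(x <- inversion_seq ip d) x.
Proof.
move=> red; have rd := simple_word_root (proj1 red).
have rseq := inversion_seq_root split_g ip_inv rd.
rewrite /phi; have -> : inversion_roots Sigma (refl_prod ip d) =
    [set` inversion_seq ip d]%classic.
  apply/seteqP; split=> x /=; first exact: inversion_roots_sub (proj1 red).
  exact: reduced_inversion_seq_pos.
rewrite -fsbig_seq ?reduced_inversion_seq_uniq //.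
rewrite [LHS]big_seq [RHS]big_seq; apply: eq_bigr => x /rseq rx.
by rewrite (dim_root_space split_g) // scale1r.
Qed.

(** The map [F] records the pairings with the simple coroots as coordinates. It is injective, as a
    vector orthogonal to all simple roots is orthogonal to itself; [rho] is the preimage of the
    vector with all coordinates 1. *)
Lemma exists_rho : exists rho,
  forall delta, delta \in Sigma -> ip (coroot ip delta) rho = 1.
Proof.
pose F x := \sum_(i < n) ip (coroot ip (tnth Sigma i)) x *: tnth Sigma i.
have Flin : linear F.
  move=> c x y; rewrite scaler_sumr -big_split /=; apply: eq_bigr => i _.
  by rewrite (ipDr ip_inv) (ipZr ip_inv) scalerDl scalerA.
pose L : {linear E -> E} := HB.pack F (GRing.isLinear.Build R _ _ _ _ Flin).
have coordF x i : coord Sigma i (F x) = ip (coroot ip (tnth Sigma i)) x.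
  rewrite /F linear_sum (bigD1 i) //= linearZ /= coord_simple eqxx.
  rewrite big1 => [|j ji]; first by rewrite addr0; exact: mulr1.
  by rewrite linearZ /= coord_simple eq_sym (negPf ji); exact: mulr0.
have kerL : lker (linfun L) == 0%VS.
  rewrite -subv0; apply/subvP => x; rewrite memv_ker memv0 lfunE /= => /eqP Fx.
  rewrite -(ip_eq0 ip_inv) [X in ip _ X](coord_basis Sigma_basis (memvf x)).
  rewrite (ip_sumr ip_inv) big1 // => i _.
  have /eqP := coordF x i; rewrite Fx linear0 eq_sym (ipZl ip_inv) mulf_eq0.
  have iS : tnth Sigma i \in Sigma by exact: mem_tnth.
  rewrite mulf_eq0 invr_eq0 (ip_eq0 ip_inv) pnatr_eq0 /=.
  rewrite (negPf (root_neq0 (Sigma_root iS))) /= => /eqP ipx.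
  by rewrite (ipZr ip_inv) (ip_sym ip_inv) -(tnth_nth 0) ipx mulr0.
exists (((linfun L)^-1)%VF (\sum_(i < n) tnth Sigma i)) => delta /tnthP [j ->].
rewrite -coordF -[F _](lfunE L) lker0_lfunVK // linear_sum (bigD1 j) //=.
rewrite coord_simple eqxx big1 ?addr0 // => i ij.
by rewrite coord_simple eq_sym (negPf ij).
Qed.

(** Both sides are linear in [x] and equal 1 on the simple coroots, which form a basis. *)
Lemma height_coroot rho x :
  (forall delta, delta \in Sigma -> ip (coroot ip delta) rho = 1) ->
  height (map_tuple (coroot ip) Sigma) x = ip x rho.
Proof.
move=> rhoP; set S := map_tuple _ _.
have S_basis : basis_of fullv S.
  rewrite basisEdim size_tuple (size_basis Sigma_basis) leqnn andbT.
  rewrite -(span_basis Sigma_basis); apply/span_subvP => y yS.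
  have N0 : ip y y != 0 by rewrite (ip_eq0 ip_inv) (root_neq0 (Sigma_root yS)).
  have -> : y = (ip y y / 2) *: coroot ip y.
    by rewrite /coroot scalerA mulrA divfK ?divff ?scale1r ?pnatr_eq0.
  by rewrite memvZ // memv_span // map_f.
rewrite [X in ip X _](coord_basis S_basis (memvf x)) (ip_sym ip_inv).
rewrite (ip_sumr ip_inv); apply: eq_bigr => i _.
rewrite (ipZr ip_inv) (ip_sym ip_inv) -tnth_nth tnth_map rhoP ?mulr1 //.
exact: mem_tnth.
Qed.

(** Supplies the uniqueness of the root in [kappa]. Equal reflections make the two roots
    proportional, with a nonnegative factor by positivity; undoing the word compares with a multiple
    of the simple root [delta], so the factor is 1. *)
Lemma pos_reflection_inj d delta beta : is_simple_word Sigma d ->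
  delta \in Sigma -> pos_roots Sigma (refl_prod ip d delta) ->
  pos_roots Sigma beta ->
  reflection ip beta = reflection ip (refl_prod ip d delta) ->
  beta = refl_prod ip d delta.
Proof.
move=> sd dS; have rw := simple_word_root sd.
set w := refl_prod ip d; set al := w delta => pal pb sE.
have [[ra _] [rb _]] := (pal, pb); have al0 := root_neq0 ra.
have kerw : lker w == 0%VS.
  by rewrite (isometry_lker0 ip_inv) //; exact: refl_prod_isometry.
pose c := ip (coroot ip beta) al.
have alE : 2 *: al = c *: beta.
  have := reflection_self ip_inv al0; rewrite -sE (reflectionE ip_inv) -/c.
  move=> /(canRL (subrK _)) H.
  by rewrite scaler_nat mulr2n {1}H addrAC addNr add0r.
have c0 : c != 0.
  apply: contra_neq al0 => c0; move: alE; rewrite c0 scale0r => /eqP.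
  by rewrite scaler_eq0 pnatr_eq0 => /eqP.
have betaE : beta = (2 / c) *: al.
  by rewrite mulrC -scalerA alE scalerA mulVf // scale1r.
have c_ge0 : 0 <= 2 / c.
  rewrite leNgt; apply/negP => cneg; apply: (pos_not_neg pal).
  split=> // i; have [_ /(_ i)] := pb; rewrite betaE linearZ /=.
  by rewrite nmulr_rge0.
rewrite betaE (@root_multiple_simple delta (2 / c)) ?scale1r //.
by rewrite -(refl_prod_root split_g ip_inv _ rw) linearZ /= -betaE.
Qed.

End SimpleSystem.

(** * Evaluation of kappa on a covering pair *)

Theorem theorem3p8 (R : realType) (g : lieVectType R) (k s a : {vspace g})
    (split_g : is_split_real_form k s a)
    (n : nat) (Sigma : n.-tuple (dual_space R a))
    (simple_Sigma : is_simple_system Sigma)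
    (ip : dual_space R a -> dual_space R a -> R)
    (ip_inv : is_weyl_invariant_inner_product ip)
    (w w' : 'End(dual_space R a))
    (Ww : weyl_group w) (Ww' : weyl_group w')
    (cov : covers Sigma ip w w')
    (l : nat) (delta : l.-tuple (dual_space R a)) (I : 'I_l)
    (dec_w : is_reduced_decomposition Sigma ip w delta)
    (dec_w' : is_reduced_decomposition Sigma ip w'
                (take I delta ++ drop I.+1 delta)) :
  let u := refl_prod ip (drop I.+1 delta) in
  let gamma := (u^-1)%VF (tnth delta I) in
  [/\ root_set gamma,
      w = (w' \o reflection ip gamma)%VF &
      (kappa Sigma ip w w')%:~R =
        height (map_tuple (coroot ip) Sigma) (coroot ip gamma)].
Proof.
move=> u gamma.
have red := reduced_decomposition_word dec_w.
have red' := reduced_decomposition_word dec_w'.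
have [sd wE _] := dec_w; have [sd' w'E _] := dec_w'.
have Sigma_root x : x \in Sigma -> root_set x.
  by case: simple_Sigma => H _ _; apply: H.
pose d1 := take I delta; pose d2 := drop I.+1 delta.
pose x := tnth delta I.
have deltaE : delta = d1 ++ x :: d2 :> seq _.
  by rewrite /x (tnth_nth 0) -drop_nth ?size_tuple // cat_take_drop.
have sd1 : is_simple_word Sigma d1.
  by move=> y yd; apply: sd'; rewrite mem_cat yd.
have sd2 : is_simple_word Sigma d2.
  by move=> y yd; apply: sd'; rewrite mem_cat yd orbT.
have xS : x \in Sigma by apply: sd; exact: mem_tnth.
have rd2 := simple_word_root simple_Sigma sd2.
have rd := simple_word_root simple_Sigma sd.
have rd' := simple_word_root simple_Sigma sd'.
have iso_u : ip_isometry ip u := refl_prod_isometry ip_inv rd2.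
have iso_w' : ip_isometry ip w' by rewrite w'E; exact: refl_prod_isometry.
have ug : u gamma = x by rewrite lker0_lfunVK // (isometry_lker0 ip_inv).
have rg : root_set gamma.
  by rewrite -(refl_prod_root split_g ip_inv _ rd2) -/u ug; apply: Sigma_root.
rewrite refl_prod_cat -/d1 -/d2 -/u in w'E.
(* As [u gamma = x], conjugation moves the omitted reflection from the left of [u] to its right. *)
have wg : w = (w' \o reflection ip gamma)%VF.
  rewrite wE deltaE refl_prod_cat /= -/u -ug.
  by rewrite (reflection_conj ip_inv _ iso_u) comp_lfunA -w'E.
split=> //.
pose beta := refl_prod ip d1 x.
have w'g : w' gamma = beta by rewrite w'E comp_lfunE ug.
have wb : w = (reflection ip beta \o w')%VF.
  by rewrite wg -w'g (reflection_conj ip_inv _ iso_w').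
have beta_in : beta \in inversion_seq ip delta.
  by rewrite deltaE; exact: mem_inversion_seq.
have [pb _] :=
  reduced_inversion_seq_pos split_g ip_inv simple_Sigma red beta_in.
have [rho rhoP] := exists_rho ip_inv simple_Sigma.
pose c := ip (coroot ip gamma) rho.
have rho_d d : is_simple_word Sigma d -> forall y, y \in d ->
    ip (coroot ip y) rho = 1.
  by move=> sd0 y /sd0; apply: rhoP.
have phiE : phi Sigma w - phi Sigma w' = c *: beta.
  have -> : phi Sigma w' = rho - w' rho.
    rewrite [in LHS]w'E -refl_prod_cat.
    rewrite (phi_reduced split_g ip_inv simple_Sigma red').
    by rewrite (sum_inversion_seq ip_inv rd' (rho_d _ sd')) refl_prod_cat -w'E.
  have -> : phi Sigma w = rho - w rho.
    rewrite [in LHS]wE (phi_reduced split_g ip_inv simple_Sigma red).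
    by rewrite (sum_inversion_seq ip_inv rd (rho_d _ sd)) -wE.
  rewrite opprB addrC addrA subrK wg comp_lfunE (reflectionE ip_inv).
  by rewrite [w' (_ - _)]linearB linearZ_LR /= w'g opprB addrC subrK.
(* [kappa] takes integer values, so [c] must be an integer. Applying [u] turns it into the pairing
   of the coroot of [x] with [u rho], which is [rho] minus a sum of roots: 1 minus Cartan
   integers. *)
have c_int : c \is a Num.int.
  rewrite /c -iso_u -(coroot_isometry _ iso_u) ug.
  have -> : u rho = rho - \sum_(y <- inversion_seq ip d2) y.
    by rewrite (sum_inversion_seq ip_inv rd2 (rho_d _ sd2)) opprB addrC subrK.
  rewrite (ipDr ip_inv) (ipNr ip_inv) rhoP // (ip_sumr ip_inv).
  rewrite rpredB ?rpred1 // big_seq rpred_sum // => y yd.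
  apply: (pairing_int split_g ip_inv); first exact: Sigma_root.
  exact: (inversion_seq_root split_g ip_inv rd2 yd).
have [m cE] := intrP c_int.
rewrite (height_coroot ip_inv simple_Sigma _ rhoP) -/c cE; congr (_%:~R).
apply: xget_unique; first by exists beta; split=> //; rewrite phiE cE.
move=> m' [beta' [pb' wb' phiE']].
(* Cancelling the invertible [w'] shows that the two reflections agree; the roots then agree, and so
   do the integers because [beta] is nonzero. *)
have bb : beta' = beta.
  apply: (pos_reflection_inj split_g ip_inv simple_Sigma sd1 xS) => //.
  have := wb; rewrite {1}wb' => /(congr1 (fun f => f \o w'^-1)%VF).
  by rewrite !lker0_compfK // (isometry_lker0 ip_inv).
move: phiE'; rewrite phiE bb cE => /eqP; rewrite -subr_eq0 -scalerBl.
rewrite scaler_eq0 (negPf (root_neq0 (proj1 pb))) orbF subr_eq0 eqr_int.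
by move/eqP.
Qed.
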